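(* Let $\mathcal{C}$ be a braided monoidal category, let $\tilde H=(H,\alpha,\tilde m_H,\eta_H,\tilde\Delta_H,\varepsilon_H)$ be a bialgebra in $\widetilde{\mathcal{H}}(\mathcal{C})$, and let $(V,\nu)$ be an object of $\widetilde{\mathcal{H}}(\mathcal{C})$. Regard $(H\otimes V,\alpha\otimes\nu)$ as a left $\tilde H$-Hopf module with the canonical action $(\tilde m_H\otimes id_V)\circ\tilde a^{-1}_{H,H,V}:H\otimes(H\otimes V)\to H\otimes V$ and the canonical coaction $\tilde a_{H,H,V}\circ(\tilde\Delta_H\otimes id_V):H\otimes V\to H\otimes(H\otimes V)$. Then there is a one-to-one correspondence between right $\tilde H$-comodule structures on $H\otimes V$ making it a left-covariant $\tilde H$-bicomodule and right $\tilde H$-comodule structures on $(V,\nu)$.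
   Context: For a monoidal category $\mathcal{C}=(\mathcal{C},\otimes,I,a,l,r)$, $\widetilde{\mathcal{H}}(\mathcal{C})$ is the category of pairs $(A,\alpha)$ with $A\in\mathcal{C}$, $\alpha\in\mathrm{Aut}_{\mathcal{C}}(A)$, morphisms $f:(A,\alpha)\to(B,\beta)$ being morphisms $f:A\to B$ with $\beta f=f\alpha$; it is monoidal with $(A,\alpha)\otimes(B,\beta)=(A\otimes B,\alpha\otimes\beta)$, unit $(I,id)$, $\tilde a_{A,B,C}=a_{A,B,C}\circ((\alpha\otimes id_B)\otimes\gamma^{-1})$ for $(C,\gamma)$, $\tilde l_A=\alpha\circ l_A$, $\tilde r_A=\alpha\circ r_A$. If $\mathcal{C}$ is braided with braiding $\tau$, so is $\widetilde{\mathcal{H}}(\mathcal{C})$ with the same $\tau$. A bialgebra $\tilde H$ in $\widetilde{\mathcal{H}}(\mathcal{C})$ is given by a bialgebra $(H,m_H,\eta_H,\Delta_H,\varepsilon_H)$ in $\mathcal{C}$ and a bialgebra automorphism $\alpha$ via $\tilde m_H=\alpha\circ m_H$, $\tilde\Delta_H=\Delta_H\circ\alpha^{-1}$. All structure maps are morphisms in $\widetilde{\mathcal{H}}(\mathcal{C})$. Left module $\psi:H\otimes M\to M$: $\psi(id_H\otimes\psi)\tilde a_{H,H,M}=\psi(\tilde m_H\otimes id_M)$, $\psi(\eta_H\otimes id_M)=\tilde l_M$. Left comodule $\rho:M\to H\otimes M$: $\tilde a_{H,H,M}(\tilde\Delta_H\otimes id_M)\rho=(id_H\otimes\rho)\rho$,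 $(\varepsilon_H\otimes id_M)\rho=\tilde l_M^{-1}$. Right comodule $\sigma:M\to M\otimes H$: $\tilde a_{M,H,H}(\sigma\otimes id_H)\sigma=(id_M\otimes\tilde\Delta_H)\sigma$, $(id_M\otimes\varepsilon_H)\sigma=\tilde r_M^{-1}$. Let $t_{X,Y,Z,W}=\tilde a_{X\otimes Z,Y,W}(\tilde a^{-1}_{X,Z,Y}\otimes id_W)((id_X\otimes\tau_{Y,Z})\otimes id_W)(\tilde a_{X,Y,Z}\otimes id_W)\tilde a^{-1}_{X\otimes Y,Z,W}:(X\otimes Y)\otimes(Z\otimes W)\to(X\otimes Z)\otimes(Y\otimes W)$. The codiagonal left and right coactions on $H\otimes M$ are $\rho'=(\tilde m_H\otimes id_{H\otimes M})\,t_{H,H,H,M}(\tilde\Delta_H\otimes\rho)$ and $\sigma'=(id_{H\otimes M}\otimes\tilde m_H)\,t_{H,H,M,H}(\tilde\Delta_H\otimes\sigma)$. A left $\tilde H$-Hopf module is a left module and left comodule with $\rho\psi=(id_H\otimes\psi)\rho'$. A left-covariant $\tilde H$-bicomodule is an object with a left action $\psi$, a left coaction $\rho$ and a right coaction $\sigma$ such that $\tilde a_{H,M,H}(\rho\otimes id_H)\sigma=(id_H\otimes\sigma)\rho$ (bicomodule condition), $\rho\psi=(id_H\otimes\psi)\rho'$ and $\sigma\psi=(\psi\otimes id_H)\sigma'$ (left and right colinearity of $\psi$). *)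

(* Defs.v *)
From Stdlib Require Import ProofIrrelevance.
From mathcomp Require Import ssreflect ssrfun ssrbool.

Set Implicit Arguments.
Unset Strict Implicit.
Unset Printing Implicit Defensive.

Declare Scope cat_scope.
Delimit Scope cat_scope with cat.
Local Open Scope cat_scope.

Reserved Notation "g ∘ f" (at level 40, left associativity).
Reserved Notation "A ⊗ B" (at level 36, left associativity).
Reserved Notation "f ⊗₁ g" (at level 36, left associativity).

Record category := Category {
  ob :> Type;
  hom : ob -> ob -> Type;
  idm : forall A, hom A A;
  compm : forall A B C, hom B C -> hom A B -> hom A C;
  compA : forall A B C D (h : hom C D) (g : hom B C) (f : hom A B),
    compm h (compm g f) = compm (compm h g) f;
  comp1m : forall A B (f : hom A B), compm (idm B) f = f;
  compm1 : forall A B (f : hom A B), compm f (idm A) = f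
}.
Arguments hom {c} A B : rename.
Arguments idm {c} A : rename.
Arguments compm {c A B C} g f : rename.

Notation "g ∘ f" := (compm g f) : cat_scope.

Record iso (C : category) (A B : C) := Iso {
  fwd :> hom A B;
  inv : hom B A;
  inv_fwd : inv ∘ fwd = idm A;
  fwd_inv : fwd ∘ inv = idm B
}.

Definition aut (C : category) (A : C) := iso A A.

Record monoidalCategory := MonoidalCategory {
  mcat :> category;
  tens : mcat -> mcat -> mcat;
  tensm : forall A A' B B' : mcat,
    hom A A' -> hom B B' -> hom (tens A B) (tens A' B');
  unitob : mcat;
  assoc : forall A B C : mcat, iso (tens (tens A B) C) (tens A (tens B C));
  lunit : forall A : mcat, iso (tens unitob A) A;
  runit : forall A : mcat, iso (tens A unitob) A;
  tens1 : forall A B : mcat, tensm (idm A) (idm B) = idm (tens A B);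
  tens_comp : forall (A A' A'' B B' B'' : mcat)
      (f' : hom A' A'') (f : hom A A') (g' : hom B' B'') (g : hom B B'),
    tensm (f' ∘ f) (g' ∘ g) = tensm f' g' ∘ tensm f g;
  assoc_nat : forall (A A' B B' C C' : mcat)
      (f : hom A A') (g : hom B B') (h : hom C C'),
    assoc A' B' C' ∘ tensm (tensm f g) h
    = tensm f (tensm g h) ∘ assoc A B C;
  lunit_nat : forall (A A' : mcat) (f : hom A A'),
    lunit A' ∘ tensm (idm unitob) f = f ∘ lunit A;
  runit_nat : forall (A A' : mcat) (f : hom A A'),
    runit A' ∘ tensm f (idm unitob) = f ∘ runit A;
  pentagon : forall A B C D : mcat,
    assoc A B (tens C D) ∘ assoc (tens A B) C D
    = tensm (idm A) (assoc B C D) ∘ assoc A (tens B C) D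
      ∘ tensm (assoc A B C) (idm D);
  triangle : forall A B : mcat,
    tensm (idm A) (lunit B) ∘ assoc A unitob B = tensm (runit A) (idm B)
}.
Arguments tens {m} A B : rename.
Arguments tensm {m A A' B B'} f g : rename.
Arguments unitob {m} : rename.
Arguments assoc {m} A B C : rename.
Arguments lunit {m} A : rename.
Arguments runit {m} A : rename.

Notation "A ⊗ B" := (tens A B) : cat_scope.
Notation "f ⊗₁ g" := (tensm f g) : cat_scope.

Record braidedMonoidalCategory := BraidedMonoidalCategory {
  bcat :> monoidalCategory;
  braid : forall A B : bcat, iso (A ⊗ B) (B ⊗ A);
  braid_nat : forall (A A' B B' : bcat) (f : hom A A') (g : hom B B'),
    braid A' B' ∘ (f ⊗₁ g) = (g ⊗₁ f) ∘ braid A B;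
  hexagon1 : forall A B C : bcat,
    assoc B C A ∘ braid A (B ⊗ C) ∘ assoc A B C
    = (idm B ⊗₁ braid A C) ∘ assoc B A C ∘ (braid A B ⊗₁ idm C);
  hexagon2 : forall A B C : bcat,
    inv (assoc C A B) ∘ braid (A ⊗ B) C ∘ inv (assoc A B C)
    = (braid A C ⊗₁ idm B) ∘ inv (assoc A C B) ∘ (idm A ⊗₁ braid B C)
}.
Arguments braid {b} A B : rename.

(* The middle-four interchange; in tilde_H below, the automorphisms coming from
   the four associators cancel. *)
Definition interchange (D : braidedMonoidalCategory) (X Y Z W : D) :
    hom ((X ⊗ Y) ⊗ (Z ⊗ W)) ((X ⊗ Z) ⊗ (Y ⊗ W)) :=
  assoc (X ⊗ Z) Y W
  ∘ (inv (assoc X Z Y) ⊗₁ idm W)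
  ∘ ((idm X ⊗₁ braid Y Z) ⊗₁ idm W)
  ∘ (assoc X Y Z ⊗₁ idm W)
  ∘ inv (assoc (X ⊗ Y) Z W).

Record bialgebra (D : braidedMonoidalCategory) := Bialgebra {
  bob :> D;
  mul : hom (bob ⊗ bob) bob;
  eta : hom unitob bob;
  delta : hom bob (bob ⊗ bob);
  eps : hom bob unitob;
  mul_assoc :
    mul ∘ (mul ⊗₁ idm bob) = mul ∘ (idm bob ⊗₁ mul) ∘ assoc bob bob bob;
  mul_unitl : mul ∘ (eta ⊗₁ idm bob) = lunit bob;
  mul_unitr : mul ∘ (idm bob ⊗₁ eta) = runit bob;
  delta_coassoc :
    assoc bob bob bob ∘ (delta ⊗₁ idm bob) ∘ delta
    = (idm bob ⊗₁ delta) ∘ delta;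
  delta_counitl : (eps ⊗₁ idm bob) ∘ delta = inv (lunit bob);
  delta_counitr : (idm bob ⊗₁ eps) ∘ delta = inv (runit bob);
  delta_mul :
    delta ∘ mul
    = (mul ⊗₁ mul) ∘ interchange bob bob bob bob ∘ (delta ⊗₁ delta);
  delta_eta : delta ∘ eta = (eta ⊗₁ eta) ∘ inv (lunit unitob);
  eps_mul : eps ∘ mul = lunit unitob ∘ (eps ⊗₁ eps);
  eps_eta : eps ∘ eta = idm unitob
}.
Arguments mul {D} b : rename.
Arguments eta {D} b : rename.
Arguments delta {D} b : rename.
Arguments eps {D} b : rename.

Definition left_module (D : braidedMonoidalCategory) (H : bialgebra D) (M : D)
    (psi : hom (H ⊗ M) M) : Prop :=
  psi ∘ (idm H ⊗₁ psi) ∘ assoc H H M = psi ∘ (mul H ⊗₁ idm M)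
  /\ psi ∘ (eta H ⊗₁ idm M) = lunit M.

Arguments left_module {D} H {M}.

Definition left_comodule (D : braidedMonoidalCategory) (H : bialgebra D)
    (M : D) (rho : hom M (H ⊗ M)) : Prop :=
  assoc H H M ∘ (delta H ⊗₁ idm M) ∘ rho = (idm H ⊗₁ rho) ∘ rho
  /\ (eps H ⊗₁ idm M) ∘ rho = inv (lunit M).

Arguments left_comodule {D} H {M}.

Definition right_comodule (D : braidedMonoidalCategory) (H : bialgebra D)
    (M : D) (sigma : hom M (M ⊗ H)) : Prop :=
  assoc M H H ∘ (sigma ⊗₁ idm H) ∘ sigma = (idm M ⊗₁ delta H) ∘ sigma
  /\ (idm M ⊗₁ eps H) ∘ sigma = inv (runit M).

Arguments right_comodule {D} H {M}.

Definition codiag_left_coaction (D : braidedMonoidalCategory)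
    (H : bialgebra D) (M : D) (rho : hom M (H ⊗ M)) :
    hom (H ⊗ M) (H ⊗ (H ⊗ M)) :=
  (mul H ⊗₁ idm (H ⊗ M)) ∘ interchange H H H M ∘ (delta H ⊗₁ rho).

Arguments codiag_left_coaction {D} H {M}.

Definition codiag_right_coaction (D : braidedMonoidalCategory)
    (H : bialgebra D) (M : D) (sigma : hom M (M ⊗ H)) :
    hom (H ⊗ M) ((H ⊗ M) ⊗ H) :=
  (idm (H ⊗ M) ⊗₁ mul H) ∘ interchange H H M H ∘ (delta H ⊗₁ sigma).

Arguments codiag_right_coaction {D} H {M}.

Definition left_hopf_module (D : braidedMonoidalCategory) (H : bialgebra D)
    (M : D) (psi : hom (H ⊗ M) M) (rho : hom M (H ⊗ M)) : Prop :=
  [/\ left_module H psi,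
      left_comodule H rho
    & rho ∘ psi = (idm H ⊗₁ psi) ∘ codiag_left_coaction H rho].

Arguments left_hopf_module {D} H {M}.

Definition left_covariant_bicomodule (D : braidedMonoidalCategory)
    (H : bialgebra D) (M : D) (psi : hom (H ⊗ M) M) (rho : hom M (H ⊗ M))
    (sigma : hom M (M ⊗ H)) : Prop :=
  [/\ left_hopf_module H psi rho,
      right_comodule H sigma,
      assoc H M H ∘ (rho ⊗₁ idm H) ∘ sigma = (idm H ⊗₁ sigma) ∘ rho
    & sigma ∘ psi = (psi ⊗₁ idm H) ∘ codiag_right_coaction H sigma].

Arguments left_covariant_bicomodule {D} H {M}.

Definition canonical_action (D : braidedMonoidalCategory) (H : bialgebra D)
    (V : D) : hom (H ⊗ (H ⊗ V)) (H ⊗ V) :=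
  (mul H ⊗₁ idm V) ∘ inv (assoc H H V).

Definition canonical_coaction (D : braidedMonoidalCategory) (H : bialgebra D)
    (V : D) : hom (H ⊗ V) (H ⊗ (H ⊗ V)) :=
  assoc H H V ∘ (delta H ⊗₁ idm V).

Record tilde_ob (C : category) := TildeOb {
  tob : C;
  taut : aut tob
}.

Record tilde_hom (C : category) (X Y : tilde_ob C) := TildeHom {
  thom :> hom (tob X) (tob Y);
  thomP : taut Y ∘ thom = thom ∘ taut X
}.

Lemma tilde_hom_eq (C : category) (X Y : tilde_ob C) (f g : tilde_hom X Y) :
  thom f = thom g -> f = g.
Proof.
case: f g => [f fP] [g gP] /= E; subst g.
by rewrite (proof_irrelevance _ fP gP).
Qed.

Lemma tilde_id_subproof (C : category) (X : tilde_ob C) :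
  taut X ∘ idm (tob X) = idm (tob X) ∘ taut X.
Proof. by rewrite compm1 comp1m. Qed.

Definition tilde_id (C : category) (X : tilde_ob C) : tilde_hom X X :=
  TildeHom (tilde_id_subproof X).

Lemma tilde_comp_subproof (C : category) (X Y Z : tilde_ob C)
    (g : tilde_hom Y Z) (f : tilde_hom X Y) :
  taut Z ∘ (thom g ∘ thom f) = thom g ∘ thom f ∘ taut X.
Proof. by rewrite compA thomP -compA thomP compA. Qed.

Definition tilde_comp (C : category) (X Y Z : tilde_ob C)
    (g : tilde_hom Y Z) (f : tilde_hom X Y) : tilde_hom X Z :=
  TildeHom (tilde_comp_subproof g f).

Definition tilde_cat (C : category) : category.
Proof.
refine (@Category (tilde_ob C) (@tilde_hom C) (@tilde_id C) (@tilde_comp C)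
  _ _ _).
- by move=> *; apply: tilde_hom_eq; apply: compA.
- by move=> *; apply: tilde_hom_eq; apply: comp1m.
- by move=> *; apply: tilde_hom_eq; apply: compm1.
Defined.

Lemma tilde_inv_subproof (C : category) (X Y : tilde_ob C)
    (f : iso (tob X) (tob Y)) :
  taut Y ∘ f = f ∘ taut X -> taut X ∘ inv f = inv f ∘ taut Y.
Proof.
move=> fP; rewrite -[LHS]comp1m -(inv_fwd f) -!compA; congr (_ ∘ _).
by rewrite !compA -fP -compA fwd_inv compm1.
Qed.

Lemma tilde_hom_inv (C : category) (X Y : tilde_ob C) (f : tilde_hom X Y) :
  inv (taut Y) ∘ f = f ∘ inv (taut X).
Proof.
rewrite -[LHS]compm1 -(fwd_inv (taut X)) !compA; congr (_ ∘ _).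
by rewrite -compA -thomP compA inv_fwd comp1m.
Qed.

Definition tilde_iso (C : category) (X Y : tilde_cat C)
    (f : iso (tob X) (tob Y)) (fP : taut Y ∘ f = f ∘ taut X) : iso X Y :=
  @Iso (tilde_cat C) X Y (TildeHom fP) (TildeHom (tilde_inv_subproof fP))
    (tilde_hom_eq (f := tilde_comp (TildeHom (tilde_inv_subproof fP))
       (TildeHom fP)) (g := tilde_id X) (inv_fwd f))
    (tilde_hom_eq (f := tilde_comp (TildeHom fP)
       (TildeHom (tilde_inv_subproof fP))) (g := tilde_id Y) (fwd_inv f)).

Definition id_iso (C : category) (A : C) : iso A A :=
  Iso (comp1m (idm A)) (comp1m (idm A)).

Definition inv_iso (C : category) (A B : C) (f : iso A B) : iso B A :=
  Iso (fwd_inv f) (inv_fwd f).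

Lemma comp_iso_subproof (C : category) (A B E : C) (g : iso B E) (f : iso A B) :
  inv f ∘ inv g ∘ (g ∘ f) = idm A.
Proof. by rewrite -compA (compA (inv g)) inv_fwd comp1m inv_fwd. Qed.

Definition comp_iso (C : category) (A B E : C) (g : iso B E) (f : iso A B) :
    iso A E :=
  @Iso C A E (g ∘ f) (inv f ∘ inv g) (comp_iso_subproof g f)
    (comp_iso_subproof (inv_iso f) (inv_iso g)).

Lemma tens_iso_subproof (C : monoidalCategory) (A A' B B' : C)
    (f : iso A A') (g : iso B B') :
  (inv f ⊗₁ inv g) ∘ (f ⊗₁ g) = idm (A ⊗ B).
Proof. by rewrite -tens_comp !inv_fwd tens1. Qed.

Definition tens_iso (C : monoidalCategory) (A A' B B' : C)
    (f : iso A A') (g : iso B B') : iso (A ⊗ B) (A' ⊗ B') :=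
  @Iso C (A ⊗ B) (A' ⊗ B') (f ⊗₁ g) (inv f ⊗₁ inv g)
    (tens_iso_subproof f g) (tens_iso_subproof (inv_iso f) (inv_iso g)).

Definition tilde_tens (C : monoidalCategory) (X Y : tilde_cat C) :
    tilde_cat C :=
  @TildeOb C (tob X ⊗ tob Y) (tens_iso (taut X) (taut Y)).

Lemma tilde_tensm_subproof (C : monoidalCategory) (X X' Y Y' : tilde_cat C)
    (f : hom X X') (g : hom Y Y') :
  (taut X' ⊗₁ taut Y') ∘ (thom f ⊗₁ thom g)
  = (thom f ⊗₁ thom g) ∘ (taut X ⊗₁ taut Y).
Proof. by rewrite -!tens_comp !thomP. Qed.

Definition tilde_tensm (C : monoidalCategory) (X X' Y Y' : tilde_cat C)
    (f : hom X X') (g : hom Y Y') :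
    hom (tilde_tens X Y) (tilde_tens X' Y') :=
  @TildeHom C (tilde_tens X Y) (tilde_tens X' Y') (thom f ⊗₁ thom g)
    (tilde_tensm_subproof f g).

Definition tilde_unit (C : monoidalCategory) : tilde_cat C :=
  @TildeOb C unitob (id_iso unitob).

(* a ∘ ((α ⊗ id) ⊗ γ^-1), where α = taut X and γ = taut Z. *)
Definition tilde_assoc_map (C : monoidalCategory) (X Y Z : tilde_cat C) :
    iso (tob (tilde_tens (tilde_tens X Y) Z))
        (tob (tilde_tens X (tilde_tens Y Z))) :=
  comp_iso (assoc (tob X) (tob Y) (tob Z))
    (tens_iso (tens_iso (taut X) (id_iso (tob Y))) (inv_iso (taut Z))).

Lemma tilde_assoc_subproof (C : monoidalCategory) (X Y Z : tilde_cat C) :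
  taut (tilde_tens X (tilde_tens Y Z)) ∘ tilde_assoc_map X Y Z
  = tilde_assoc_map X Y Z ∘ taut (tilde_tens (tilde_tens X Y) Z).
Proof.
rewrite /= compA -assoc_nat -!compA -!tens_comp.
by rewrite compm1 comp1m inv_fwd fwd_inv.
Qed.

Definition tilde_assoc (C : monoidalCategory) (X Y Z : tilde_cat C) :
    iso (tilde_tens (tilde_tens X Y) Z) (tilde_tens X (tilde_tens Y Z)) :=
  @tilde_iso C _ _ (tilde_assoc_map X Y Z) (tilde_assoc_subproof X Y Z).

Definition tilde_lunit_map (C : monoidalCategory) (X : tilde_cat C) :
    iso (tob (tilde_tens (tilde_unit C) X)) (tob X) :=
  comp_iso (taut X) (lunit (tob X)).

Lemma tilde_lunit_subproof (C : monoidalCategory) (X : tilde_cat C) :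
  taut X ∘ tilde_lunit_map X
  = tilde_lunit_map X ∘ taut (tilde_tens (tilde_unit C) X).
Proof. by rewrite /= -!compA lunit_nat. Qed.

Definition tilde_lunit (C : monoidalCategory) (X : tilde_cat C) :
    iso (tilde_tens (tilde_unit C) X) X :=
  @tilde_iso C _ _ (tilde_lunit_map X) (tilde_lunit_subproof X).

Definition tilde_runit_map (C : monoidalCategory) (X : tilde_cat C) :
    iso (tob (tilde_tens X (tilde_unit C))) (tob X) :=
  comp_iso (taut X) (runit (tob X)).

Lemma tilde_runit_subproof (C : monoidalCategory) (X : tilde_cat C) :
  taut X ∘ tilde_runit_map X
  = tilde_runit_map X ∘ taut (tilde_tens X (tilde_unit C)).
Proof. by rewrite /= -!compA runit_nat. Qed.

Definition tilde_runit (C : monoidalCategory) (X : tilde_cat C) :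
    iso (tilde_tens X (tilde_unit C)) X :=
  @tilde_iso C _ _ (tilde_runit_map X) (tilde_runit_subproof X).

Lemma tilde_pentagon_subproof (C : monoidalCategory)
    (A B X D : tilde_cat C) :
  tilde_assoc_map A B (tilde_tens X D) ∘ tilde_assoc_map (tilde_tens A B) X D
  = (idm (tob A) ⊗₁ tilde_assoc_map B X D)
    ∘ tilde_assoc_map A (tilde_tens B X) D
    ∘ (tilde_assoc_map A B X ⊗₁ idm (tob D)).
Proof.
case: A B X D => [A a] [B b] [X x] [D d] /=.
have -> : (idm A ⊗₁ (assoc B X D ∘ ((b ⊗₁ idm X) ⊗₁ inv d)))
   = (idm A ⊗₁ assoc B X D) ∘ (idm A ⊗₁ ((b ⊗₁ idm X) ⊗₁ inv d)).
  by rewrite -tens_comp comp1m.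
have -> : (assoc A B X ∘ ((a ⊗₁ idm B) ⊗₁ inv x)) ⊗₁ idm D
   = (assoc A B X ⊗₁ idm D) ∘ (((a ⊗₁ idm B) ⊗₁ inv x) ⊗₁ idm D).
  by rewrite -tens_comp comp1m.
rewrite -[LHS]compA (compA _ (assoc (A ⊗ B) X D)) -assoc_nat -compA.
rewrite compA pentagon -!compA; congr (_ ∘ _).
rewrite [RHS]compA -assoc_nat -!compA; congr (_ ∘ _).
rewrite -!tens_comp !comp1m !compm1; congr (_ ⊗₁ _).
rewrite [RHS]compA -tens_comp comp1m compm1 [RHS]compA -assoc_nat -compA.
by rewrite -!tens_comp !compm1 ?comp1m.
Qed.

Definition tilde_monoidal (C : monoidalCategory) : monoidalCategory.
Proof.
refine (@MonoidalCategory (tilde_cat C) (@tilde_tens C) (@tilde_tensm C)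
  (tilde_unit C) (@tilde_assoc C) (@tilde_lunit C) (@tilde_runit C)
  _ _ _ _ _ _ _).
- by move=> *; apply: tilde_hom_eq; apply: tens1.
- by move=> *; apply: tilde_hom_eq; apply: tens_comp.
- move=> X X' Y Y' Z Z' f g h; apply: tilde_hom_eq => /=.
  rewrite compA -assoc_nat -!compA -!tens_comp thomP comp1m compm1.
  by rewrite tilde_hom_inv.
- move=> X Y f; apply: tilde_hom_eq => /=.
  by rewrite -compA lunit_nat !compA thomP.
- move=> X Y f; apply: tilde_hom_eq => /=.
  by rewrite -compA runit_nat !compA thomP.
- move=> W X Y Z; apply: tilde_hom_eq => /=; exact: tilde_pentagon_subproof.
- move=> X Y; apply: tilde_hom_eq => /=.
  have -> : idm (tob X) ⊗₁ (taut Y ∘ lunit (tob Y))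
      = (idm (tob X) ⊗₁ taut Y) ∘ (idm (tob X) ⊗₁ lunit (tob Y)).
    by rewrite -tens_comp comp1m.
  rewrite -compA (compA _ (assoc _ _ _)) triangle.
  by rewrite -!tens_comp runit_nat !comp1m fwd_inv.
Defined.

Lemma tilde_braid_subproof (C : braidedMonoidalCategory) (X Y : tilde_cat C) :
  taut (tilde_tens Y X) ∘ braid (tob X) (tob Y)
  = braid (tob X) (tob Y) ∘ taut (tilde_tens X Y).
Proof. by rewrite /= braid_nat. Qed.

Definition tilde_braid (C : braidedMonoidalCategory) (X Y : tilde_cat C) :
    iso (tilde_tens X Y) (tilde_tens Y X) :=
  @tilde_iso C (tilde_tens X Y) (tilde_tens Y X) (braid (tob X) (tob Y))
    (tilde_braid_subproof X Y).

Lemma assoc_inv_nat (C : monoidalCategory) (A A' B B' E E' : C)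
    (f : hom A A') (g : hom B B') (h : hom E E') :
  ((f ⊗₁ g) ⊗₁ h) ∘ inv (assoc A B E)
  = inv (assoc A' B' E') ∘ (f ⊗₁ (g ⊗₁ h)).
Proof.
rewrite -[LHS]comp1m -(inv_fwd (assoc A' B' E')) -!compA; congr (_ ∘ _).
by rewrite compA assoc_nat -compA fwd_inv compm1.
Qed.

Lemma tilde_hexagon1_subproof (C : braidedMonoidalCategory)
    (A B X : tilde_cat C) :
  tilde_assoc_map B X A ∘ braid (tob A) (tob B ⊗ tob X) ∘ tilde_assoc_map A B X
  = (idm (tob B) ⊗₁ braid (tob A) (tob X)) ∘ tilde_assoc_map B A X
    ∘ (braid (tob A) (tob B) ⊗₁ idm (tob X)).
Proof.
case: A B X => [A a] [B b] [X x] /=.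
rewrite -!compA (compA _ (braid A (B ⊗ X))) -braid_nat -!compA.
rewrite (compA _ (assoc A B X)) -assoc_nat -!compA -!tens_comp.
rewrite inv_fwd !comp1m !compm1 -braid_nat -[in RHS](comp1m (inv x)) tens_comp.
by rewrite !compA hexagon1.
Qed.

Lemma tilde_hexagon2_subproof (C : braidedMonoidalCategory)
    (A B X : tilde_cat C) :
  inv (tilde_assoc_map X A B) ∘ braid (tob A ⊗ tob B) (tob X)
    ∘ inv (tilde_assoc_map A B X)
  = (braid (tob A) (tob X) ⊗₁ idm (tob B)) ∘ inv (tilde_assoc_map A X B)
    ∘ (idm (tob A) ⊗₁ braid (tob B) (tob X)).
Proof.
case: A B X => [A a] [B b] [X x] /=.
rewrite !assoc_inv_nat -!compA (compA _ (braid (A ⊗ B) X)) -braid_nat -!compA.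
rewrite (compA _ (inv (assoc A B X))) assoc_inv_nat -!compA -!tens_comp.
rewrite inv_fwd !comp1m !compm1 -braid_nat -[in RHS](comp1m (inv a)) tens_comp.
by rewrite !compA hexagon2.
Qed.

(* The structure maps of a bialgebra H in tilde_H C are the twisted ones:
   mul H = α ∘ m and delta H = Δ ∘ α^-1, where α = taut H and (m, Δ) belong to
   the bialgebra of C underlying H. *)
Definition tilde_H (C : braidedMonoidalCategory) :
  braidedMonoidalCategory.
Proof.
refine (@BraidedMonoidalCategory (tilde_monoidal C) (@tilde_braid C) _ _ _).
- by move=> *; apply: tilde_hom_eq; apply: braid_nat.
- by move=> A B X; apply: tilde_hom_eq; apply: tilde_hexagon1_subproof.
- by move=> A B X; apply: tilde_hom_eq; apply: tilde_hexagon2_subproof.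
Defined.

(* Main.v *)
(** A right coaction [s] on [V] is sent to the codiagonal coaction on [H ⊗ V];
    conversely [sigma] on [H ⊗ V] is restricted along the inclusion
    [j = η ⊗ V] of the coinvariants and projected by [ε ⊗ V].  The bicomodule
    condition says that [sigma ∘ j] is again coinvariant, so it equals
    [(j ⊗ H) ∘ s] for the restricted coaction [s]; since [H ⊗ V] is generated by
    [j] under the action, colinearity of the action then forces [sigma] to be
    the codiagonal coaction of [s].  Only the fact that [tilde_H C] is a braided
    monoidal category is needed.

    Coherence of the middle-four interchange is obtained by conjugating it with
    associators to [hop : X ⊗ (Y ⊗ Z) -> Y ⊗ (X ⊗ Z)] acting on right-nested
    tensor products, where both hexagons become [hop] of a tensor product as
    a composite of two [hop]s. *)

From mathcomp Require Import ssreflect ssrfun ssrbool.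
From Stdlib Require Import ProofIrrelevance.
Require Import Defs.

Local Open Scope cat_scope.

Set Implicit Arguments.
Unset Strict Implicit.
Unset Printing Implicit Defensive.

(** * Rewriting in right-nested composites, isomorphisms and bifunctoriality *)

(** Composites are kept right-nested, so an equation between short composites must carry a tail [h]
    in order to match inside a longer chain. *)
Lemma reassoc (C : category) (A B E : C) (g : hom B E) (f : hom A B)
    (k : hom A E) :
  g ∘ f = k -> forall Z (h : hom Z A), g ∘ (f ∘ h) = k ∘ h.
Proof. by move=> <- Z h; rewrite compA. Qed.

Lemma reassoc3 (C : category) (A B E G : C) (g : hom E G) (f : hom B E)
    (e : hom A B) (k : hom A G) :
  g ∘ (f ∘ e) = k -> forall Z (h : hom Z A), g ∘ (f ∘ (e ∘ h)) = k ∘ h.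
Proof. by move=> <- Z h; rewrite !compA. Qed.

Lemma fwdK (C : category) (A B : C) (i : iso A B) Z (h : hom Z A) :
  inv i ∘ (i ∘ h) = h.
Proof. by rewrite compA inv_fwd comp1m. Qed.

Lemma invK (C : category) (A B : C) (i : iso A B) Z (h : hom Z B) :
  i ∘ (inv i ∘ h) = h.
Proof. by rewrite compA fwd_inv comp1m. Qed.

Lemma iso_monic (C : category) (A B Z : C) (i : iso A B) (f g : hom Z A) :
  i ∘ f = i ∘ g -> f = g.
Proof. by move=> e; rewrite -(fwdK i f) e fwdK. Qed.

Lemma iso_epic (C : category) (A B Z : C) (i : iso A B) (f g : hom B Z) :
  f ∘ i = g ∘ i -> f = g.
Proof.
by move=> e; rewrite -[f]compm1 -[g]compm1 -(fwd_inv i) !compA e.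
Qed.

Lemma inv_l (C : category) (A B Z : C) (i : iso A B) (f : hom Z A)
    (g : hom Z B) :
  i ∘ f = g -> f = inv i ∘ g.
Proof. by move=> <-; rewrite fwdK. Qed.

Lemma inv_r (C : category) (A B Z : C) (i : iso A B) (f : hom B Z)
    (g : hom A Z) :
  f ∘ i = g -> f = g ∘ inv i.
Proof. by move=> <-; rewrite -compA fwd_inv compm1. Qed.

Lemma tens_compl (D : monoidalCategory) (A B E X : D) (g : hom B E)
    (f : hom A B) :
  (g ∘ f) ⊗₁ idm X = (g ⊗₁ idm X) ∘ (f ⊗₁ idm X).
Proof. by rewrite -tens_comp comp1m. Qed.

Lemma tens_compr (D : monoidalCategory) (A B E X : D) (g : hom B E)
    (f : hom A B) :
  idm X ⊗₁ (g ∘ f) = (idm X ⊗₁ g) ∘ (idm X ⊗₁ f).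
Proof. by rewrite -tens_comp comp1m. Qed.

Lemma tens_split (D : monoidalCategory) (A A' B B' : D) (f : hom A A')
    (g : hom B B') :
  f ⊗₁ g = (f ⊗₁ idm B') ∘ (idm A ⊗₁ g).
Proof. by rewrite -tens_comp comp1m compm1. Qed.

Lemma tens_exch (D : monoidalCategory) (A A' B B' : D) (f : hom A A')
    (g : hom B B') :
  (idm A' ⊗₁ g) ∘ (f ⊗₁ idm B) = (f ⊗₁ idm B') ∘ (idm A ⊗₁ g).
Proof. by rewrite -!tens_comp !comp1m !compm1. Qed.

Lemma assoc_natl (D : monoidalCategory) (A A' B E : D) (f : hom A A') :
  assoc A' B E ∘ ((f ⊗₁ idm B) ⊗₁ idm E) = (f ⊗₁ idm (B ⊗ E)) ∘ assoc A B E.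
Proof. by rewrite assoc_nat tens1. Qed.

Lemma assoc_natr (D : monoidalCategory) (A B E E' : D) (f : hom E E') :
  assoc A B E' ∘ (idm (A ⊗ B) ⊗₁ f) = (idm A ⊗₁ (idm B ⊗₁ f)) ∘ assoc A B E.
Proof. by rewrite -tens1 assoc_nat. Qed.

Lemma pentagonE (D : monoidalCategory) (A B E F : D) :
  (idm A ⊗₁ assoc B E F) ∘ (assoc A (B ⊗ E) F ∘ (assoc A B E ⊗₁ idm F))
  = assoc A B (E ⊗ F) ∘ assoc (A ⊗ B) E F.
Proof. by rewrite pentagon compA. Qed.

(** * Coherence of the unit constraints and of the braiding with the unit *)

(** Tensoring with the unit is faithful, being naturally isomorphic to the identity functor through
    [lunit]. *)
Lemma tens_unitl_inj (D : monoidalCategory) (A B : D) (f g : hom A B) :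
  idm unitob ⊗₁ f = idm unitob ⊗₁ g -> f = g.
Proof.
by move=> e; apply: (@iso_epic _ _ _ _ (lunit A)); rewrite -!lunit_nat e.
Qed.

Lemma tens_unitr_inj (D : monoidalCategory) (A B : D) (f g : hom A B) :
  f ⊗₁ idm unitob = g ⊗₁ idm unitob -> f = g.
Proof.
by move=> e; apply: (@iso_epic _ _ _ _ (runit A)); rewrite -!runit_nat e.
Qed.

Lemma pentagon_inv (D : monoidalCategory) (A B E F : D) :
  inv (assoc A (B ⊗ E) F) ∘ ((idm A ⊗₁ inv (assoc B E F)) ∘ assoc A B (E ⊗ F))
  = (assoc A B E ⊗₁ idm F) ∘ inv (assoc (A ⊗ B) E F).
Proof.
apply: inv_r; rewrite -!compA -pentagonE.
by rewrite (reassoc (esym (tens_compr _ _ _))) inv_fwd tens1 comp1m fwdK.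
Qed.

(** Kelly's argument: after tensoring with the unit on the left and precomposing with two
    associators, the pentagon and the triangle identify both sides. *)
Lemma lunit_tens (D : monoidalCategory) (A B : D) :
  lunit (A ⊗ B) ∘ assoc unitob A B = lunit A ⊗₁ idm B.
Proof.
apply: tens_unitl_inj.
apply: (iso_epic (i := comp_iso (assoc unitob (unitob ⊗ A) B)
  (tens_iso (assoc unitob unitob A) (id_iso B)))) => /=.
rewrite tens_compr -!compA pentagonE (reassoc (triangle _ _)).
rewrite [RHS]compA -assoc_nat -[in LHS]tens1 -assoc_nat -compA.
by rewrite -tens_comp triangle comp1m.
Qed.

Lemma assoc_lunit_inv (D : monoidalCategory) (A B : D) :
  assoc unitob A B ∘ (inv (lunit A) ⊗₁ idm B) = inv (lunit (A ⊗ B)).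
Proof.
rewrite -[RHS]compm1; apply: inv_l; rewrite (reassoc (lunit_tens _ _)).
by rewrite -tens_compl fwd_inv tens1.
Qed.

Lemma runit_tens (D : monoidalCategory) (A B : D) :
  (idm A ⊗₁ runit B) ∘ assoc A B unitob = runit (A ⊗ B).
Proof.
apply: tens_unitr_inj.
apply: (@iso_monic _ _ _ _ (assoc A B unitob)).
rewrite tens_compl (reassoc (assoc_nat _ _ _)) -triangle.
rewrite -[in RHS]triangle tens_compr -!compA pentagonE.
by rewrite (reassoc (assoc_natr _ _ _)) compA.
Qed.

(** [hexagon2] with two unit objects contains [braid unitob A] twice. Naturality of the braiding and
    of [lunit] leaves one common copy on the two sides, and the unit constraints agree by the
    triangle and [lunit_tens]. *)
Lemma braid_unitl (D : braidedMonoidalCategory) (A : D) :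
  runit A ∘ braid unitob A = lunit A.
Proof.
apply: tens_unitr_inj; rewrite -lunit_tens.
apply: (iso_epic (i := comp_iso (inv_iso (assoc unitob A unitob))
  (tens_iso (id_iso unitob) (braid unitob A)))) => /=.
rewrite -!compA invK lunit_nat tens_compl -!compA.
have := hexagon2 unitob unitob A; rewrite -!compA => <-.
rewrite -triangle -!compA invK (reassoc (esym (braid_nat _ _))) -!compA.
by congr (_ ∘ _); rewrite -lunit_tens -compA fwd_inv compm1.
Qed.

(** * Coherence of the middle-four interchange *)

(* [hop] and [swap4] are locked so that rewriting with [compA] does not look
   inside them. *)
Definition hop (D : braidedMonoidalCategory) (X Y Z : D) :
    hom (X ⊗ (Y ⊗ Z)) (Y ⊗ (X ⊗ Z)) :=
  locked (assoc Y X Z ∘ (braid X Y ⊗₁ idm Z) ∘ inv (assoc X Y Z)).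

Definition swap4 (D : braidedMonoidalCategory) (X Y Z W : D) :
    hom ((X ⊗ Y) ⊗ (Z ⊗ W)) ((X ⊗ Z) ⊗ (Y ⊗ W)) :=
  locked (interchange X Y Z W).

Lemma swap4E (D : braidedMonoidalCategory) (X Y Z W : D) :
  interchange X Y Z W = swap4 X Y Z W.
Proof. by rewrite /swap4 -lock. Qed.

Lemma hop_assoc (D : braidedMonoidalCategory) (X Y Z : D) :
  hop X Y Z ∘ assoc X Y Z = assoc Y X Z ∘ (braid X Y ⊗₁ idm Z).
Proof. by rewrite /hop -lock -compA inv_fwd compm1. Qed.

Lemma hop_nat (D : braidedMonoidalCategory) (X X' Y Y' Z Z' : D)
    (f : hom X X') (g : hom Y Y') (h : hom Z Z') :
  hop X' Y' Z' ∘ (f ⊗₁ (g ⊗₁ h)) = (g ⊗₁ (f ⊗₁ h)) ∘ hop X Y Z.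
Proof.
rewrite /hop -!lock -!compA -assoc_inv_nat (reassoc (esym (tens_comp _ _ _ _))).
rewrite braid_nat comp1m -[h in LHS]compm1 tens_comp !compA.
by rewrite assoc_nat.
Qed.

(** The bridge from [swap4] to [hop]: the laws of [swap4] below are checked after composing with an
    associator on the target. *)
Lemma assoc_swap4 (D : braidedMonoidalCategory) (X Y Z W : D) :
  assoc X Z (Y ⊗ W) ∘ swap4 X Y Z W
  = (idm X ⊗₁ hop Y Z W) ∘ assoc X Y (Z ⊗ W).
Proof.
rewrite -swap4E /interchange -!compA.
rewrite (reassoc (esym (pentagonE _ _ _ _))) -!compA.
rewrite (reassoc (esym (tens_compl _ _ _))) fwd_inv tens1 comp1m.
rewrite (reassoc (assoc_nat _ _ _)) -!compA.
rewrite (reassoc (esym (tens_compr _ _ _))) -hop_assoc tens_compr -!compA.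
by rewrite (reassoc3 (pentagonE _ _ _ _)) -!compA fwd_inv compm1.
Qed.

(** This is [hexagon2] with a spectator [W]: [Z] passes [Y'] first and then [Y]. *)
Lemma hop_tensl (D : braidedMonoidalCategory) (Y Y' Z W : D) :
  (idm Z ⊗₁ assoc Y Y' W) ∘ hop (Y ⊗ Y') Z W
  = hop Y Z (Y' ⊗ W) ∘ (idm Y ⊗₁ hop Y' Z W) ∘ assoc Y Y' (Z ⊗ W).
Proof.
apply: (@iso_epic _ _ _ _ (assoc (Y ⊗ Y') Z W)).
rewrite -!compA hop_assoc -pentagonE.
have -> : fwd (braid (Y ⊗ Y') Z) = assoc Z Y Y' ∘ ((braid Y Z ⊗₁ idm Y') ∘
   (inv (assoc Y Z Y') ∘ ((idm Y ⊗₁ braid Y' Z) ∘ assoc Y Y' Z))).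
  have := hexagon2 Y Y' Z; rewrite -!compA => h.
  by rewrite (reassoc3 (esym h)) -!compA inv_fwd compm1 invK.
rewrite !tens_compl (reassoc3 (pentagonE _ _ _ _)) -!compA.
rewrite (reassoc (assoc_natl _ _ _)) -!compA.
rewrite (reassoc (esym (hop_assoc _ _ _))) -!compA; congr (_ ∘ _).
rewrite (reassoc (esym (pentagonE _ _ _ _))) -!compA.
rewrite (reassoc (esym (tens_compl _ _ _))) fwd_inv tens1 comp1m.
rewrite (reassoc (assoc_nat _ _ _)) -!compA.
by rewrite (reassoc (esym (tens_compr _ _ _))) -hop_assoc tens_compr -!compA.
Qed.

(** This is [hexagon1] with a spectator [W]: [Y] passes [Z] first and then [Z']. *)
Lemma hop_tensm (D : braidedMonoidalCategory) (Y Z Z' W : D) :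
  assoc Z Z' (Y ⊗ W) ∘ hop Y (Z ⊗ Z') W
  = (idm Z ⊗₁ hop Y Z' W) ∘ hop Y Z (Z' ⊗ W) ∘ (idm Y ⊗₁ assoc Z Z' W).
Proof.
apply: (iso_epic (i := comp_iso (assoc Y (Z ⊗ Z') W)
  (tens_iso (assoc Y Z Z') (id_iso W)))) => /=.
rewrite -!compA pentagonE (reassoc (hop_assoc _ _ _)) -!compA.
rewrite (reassoc (esym (pentagonE _ _ _ _))) -!compA -!tens_compl.
have := hexagon1 Y Z Z'; rewrite -!compA => ->.
rewrite !tens_compl (reassoc (assoc_nat _ _ _)) -!compA.
rewrite (reassoc (esym (tens_compr _ _ _))) -hop_assoc tens_compr -!compA.
rewrite (reassoc3 (pentagonE _ _ _ _)) -!compA assoc_natl.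
by rewrite (reassoc (hop_assoc _ _ _)) -!compA.
Qed.

(** The braiding inside [hop] does not touch the last factor, so enlarging that factor by [V] is a
    matter of pentagons and naturality. *)
Lemma hop_tensr (D : braidedMonoidalCategory) (X Y Z V : D) :
  (idm Y ⊗₁ assoc X Z V) ∘ assoc Y (X ⊗ Z) V ∘ (hop X Y Z ⊗₁ idm V)
  = hop X Y (Z ⊗ V) ∘ (idm X ⊗₁ assoc Y Z V) ∘ assoc X (Y ⊗ Z) V.
Proof.
apply: (iso_epic (i := tens_iso (assoc X Y Z) (id_iso V))) => /=.
rewrite -!compA pentagonE -tens_compl hop_assoc tens_compl.
rewrite (reassoc3 (pentagonE _ _ _ _)) -!compA assoc_natl.
by rewrite (reassoc (hop_assoc _ _ _)) -!compA.
Qed.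

Lemma swap4_nat (D : braidedMonoidalCategory)
    (X X' Y Y' Z Z' W W' : D)
    (f : hom X X') (g : hom Y Y') (h : hom Z Z') (k : hom W W') :
  swap4 X' Y' Z' W' ∘ ((f ⊗₁ g) ⊗₁ (h ⊗₁ k))
  = ((f ⊗₁ h) ⊗₁ (g ⊗₁ k)) ∘ swap4 X Y Z W.
Proof.
apply: (@iso_monic _ _ _ _ (assoc X' Z' (Y' ⊗ W'))).
rewrite (reassoc (assoc_swap4 _ _ _ _)) -!compA assoc_nat.
rewrite (reassoc (assoc_nat _ _ _)) -!compA assoc_swap4 !compA.
by rewrite -!tens_comp hop_nat comp1m compm1.
Qed.

Lemma assoc_assoc_swap4 (D : braidedMonoidalCategory) (X Y Z W V : D) :
  (idm X ⊗₁ (idm Z ⊗₁ assoc Y W V)) ∘ assoc X Z ((Y ⊗ W) ⊗ V)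
    ∘ assoc (X ⊗ Z) (Y ⊗ W) V ∘ (swap4 X Y Z W ⊗₁ idm V)
  = (idm X ⊗₁ hop Y Z (W ⊗ V)) ∘ (idm X ⊗₁ (idm Y ⊗₁ assoc Z W V))
    ∘ assoc X Y ((Z ⊗ W) ⊗ V) ∘ assoc (X ⊗ Y) (Z ⊗ W) V.
Proof.
rewrite -!compA (reassoc (esym (pentagonE _ _ _ _))) -!compA.
rewrite -tens_compl assoc_swap4 tens_compl.
rewrite (reassoc (assoc_nat _ _ _)) -!compA -pentagonE.
have := hop_tensr Y Z W V; rewrite -!compA => h.
by rewrite !compA -!tens_compr -!compA h.
Qed.

(** Only [Y] and [Z] are braided, so [V] can be absorbed into [W]. In [hopf_canonical] this lets [V]
    ride along with the last factor [H]. *)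
Lemma assoc_swap4_tens (D : braidedMonoidalCategory) (X Y Z W V : D) :
  (idm (X ⊗ Z) ⊗₁ assoc Y W V) ∘ assoc (X ⊗ Z) (Y ⊗ W) V
    ∘ (swap4 X Y Z W ⊗₁ idm V)
  = swap4 X Y Z (W ⊗ V) ∘ (idm (X ⊗ Y) ⊗₁ assoc Z W V)
    ∘ assoc (X ⊗ Y) (Z ⊗ W) V.
Proof.
apply: (@iso_monic _ _ _ _ (assoc X Z (Y ⊗ (W ⊗ V)))).
rewrite -!compA (reassoc (assoc_swap4 _ _ _ _)) -!compA.
rewrite !(reassoc (assoc_natr _ _ _)) !compA.
exact: assoc_assoc_swap4.
Qed.

Lemma assoc_swap4_assoc (D : braidedMonoidalCategory) (X Y Z V W : D) :
  assoc X (Y ⊗ V) (Z ⊗ W) ∘ (assoc X Y V ⊗₁ idm (Z ⊗ W))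
    ∘ swap4 (X ⊗ Y) Z V W
  = (idm X ⊗₁ swap4 Y Z V W) ∘ assoc X (Y ⊗ Z) (V ⊗ W)
    ∘ (assoc X Y Z ⊗₁ idm (V ⊗ W)).
Proof.
apply: (iso_monic (i := tens_iso (id_iso X) (assoc Y V (Z ⊗ W)))) => /=.
rewrite -!compA (reassoc3 (pentagonE _ _ _ _)) -!compA assoc_swap4.
rewrite (reassoc (assoc_natr _ _ _)) -!compA -pentagonE !compA.
by rewrite -!tens_compr assoc_swap4.
Qed.

(** Associativity of [swap4] as a monoidal constraint on the tensor functor: either side moves [Y]
    past [X'], [Y'] past [X2] and [Y] past [X2]. *)
Lemma swap4_assocl (D : braidedMonoidalCategory) (X X' X2 Y Y' Y2 : D) :
  (assoc X X' X2 ⊗₁ assoc Y Y' Y2) ∘ swap4 (X ⊗ X') (Y ⊗ Y') X2 Y2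
    ∘ (swap4 X Y X' Y' ⊗₁ idm (X2 ⊗ Y2))
  = swap4 X Y (X' ⊗ X2) (Y' ⊗ Y2) ∘ (idm (X ⊗ Y) ⊗₁ swap4 X' Y' X2 Y2)
    ∘ assoc (X ⊗ Y) (X' ⊗ Y') (X2 ⊗ Y2).
Proof.
(* The target becomes the fully right-nested product of [X], [X'], [X2], [Y], [Y'], [Y2], on which
   every interchange acts through [hop]. *)
apply: (iso_monic (i := comp_iso
  (tens_iso (id_iso X) (assoc X' X2 (Y ⊗ (Y' ⊗ Y2))))
  (assoc X (X' ⊗ X2) (Y ⊗ (Y' ⊗ Y2))))) => /=.
rewrite (tens_split (fwd (assoc X X' X2))) -!compA.
rewrite (reassoc3 (pentagonE _ _ _ _)) -!compA.
rewrite (reassoc (assoc_natr _ _ _)) -!compA.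
rewrite (reassoc (assoc_swap4 _ _ _ _)) -!compA.
have := hop_tensl Y Y' X2 Y2; rewrite -!compA => h1.
rewrite (reassoc (esym (tens_compr _ _ _))) h1 (reassoc (assoc_natr _ _ _)).
rewrite !tens_compr -!compA.
have := assoc_assoc_swap4 X Y X' Y' (X2 ⊗ Y2); rewrite -!compA => ->.
rewrite (reassoc (assoc_swap4 _ _ _ _)) -!compA.
rewrite (reassoc (assoc_natr _ _ _)).
have := hop_tensm Y X' X2 (Y' ⊗ Y2); rewrite -!compA => h2.
(* [hop_tensm] splits the passage of [Y] past [X' ⊗ X2]; [hop_nat] then lets [Y] pass [X'] before
   [Y'] passes [X2]. *)
have h3 : assoc X' X2 (Y ⊗ (Y' ⊗ Y2)) ∘ (hop Y (X' ⊗ X2) (Y' ⊗ Y2)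
      ∘ (idm Y ⊗₁ swap4 X' Y' X2 Y2))
    = (idm X' ⊗₁ hop Y X2 (Y' ⊗ Y2)) ∘ ((idm X' ⊗₁ (idm Y ⊗₁ hop Y' X2 Y2))
      ∘ (hop Y X' (Y' ⊗ (X2 ⊗ Y2)) ∘ (idm Y ⊗₁ assoc X' Y' (X2 ⊗ Y2)))).
  rewrite (reassoc h2) -!compA -tens_compr assoc_swap4 tens_compr.
  by rewrite (reassoc (hop_nat _ _ _)) -!compA.
have := congr1 (tensm (idm X)) h3; rewrite !tens_compr => h4.
by rewrite (reassoc3 h4) -!compA.
Qed.

Lemma swap4_hop (D : braidedMonoidalCategory) (A A' A2 B U : D) :
  swap4 A A' B (A2 ⊗ U) ∘ ((idm (A ⊗ A') ⊗₁ hop A2 B U)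
    ∘ assoc (A ⊗ A') A2 (B ⊗ U))
  = (idm (A ⊗ B) ⊗₁ assoc A' A2 U) ∘ swap4 A (A' ⊗ A2) B U
    ∘ (assoc A A' A2 ⊗₁ idm (B ⊗ U)).
Proof.
apply: (@iso_monic _ _ _ _ (assoc A B (A' ⊗ (A2 ⊗ U)))).
rewrite -!compA (reassoc (assoc_swap4 _ _ _ _)) -!compA.
rewrite !(reassoc (assoc_natr _ _ _)) -!compA.
rewrite (reassoc (assoc_swap4 _ _ _ _)) -!compA -pentagonE.
have := congr1 (tensm (idm A)) (hop_tensl A' A2 B U); rewrite !tens_compr => h.
by rewrite (reassoc h) -!compA.
Qed.

(** The dual coassociativity law. [hop_tensm] splits the passage of [A2] past [B ⊗ B']: the part
    past [B'] slides through [swap4] by naturality, and the part past [B] merges with that of [A']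
    by [swap4_hop]. *)
Lemma swap4_assocr (D : braidedMonoidalCategory) (A A' A2 B B' B2 : D) :
  assoc (A ⊗ B) (A' ⊗ B') (A2 ⊗ B2) ∘ (swap4 A A' B B' ⊗₁ idm (A2 ⊗ B2))
    ∘ swap4 (A ⊗ A') A2 (B ⊗ B') B2
  = (idm (A ⊗ B) ⊗₁ swap4 A' A2 B' B2) ∘ swap4 A (A' ⊗ A2) B (B' ⊗ B2)
    ∘ (assoc A A' A2 ⊗₁ assoc B B' B2).
Proof.
apply: (iso_monic (i := tens_iso (id_iso (A ⊗ B))
   (assoc A' B' (A2 ⊗ B2)))) => /=.
have := assoc_swap4_tens A A' B B' (A2 ⊗ B2); rewrite -!compA => h.
rewrite (reassoc3 h) -!compA assoc_swap4.
rewrite (reassoc (esym (tens_compr _ _ _))).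
have := hop_tensm A2 B B' B2; rewrite -!compA => h1.
rewrite h1 !tens_compr -!compA.
have := swap4_nat (idm A) (idm A') (idm B) (hop A2 B' B2); rewrite !tens1 => h2.
rewrite (reassoc h2) -!compA -assoc_natr (reassoc3 (swap4_hop _ _ _ _ _)).
rewrite -!compA -tens_split (reassoc (esym (tens_compr _ _ _))) -assoc_swap4.
by rewrite tens_compr -!compA.
Qed.

Lemma hop_unitl (D : braidedMonoidalCategory) (A B : D) :
  (idm A ⊗₁ lunit B) ∘ hop unitob A B = lunit (A ⊗ B).
Proof.
apply: (@iso_epic _ _ _ _ (assoc unitob A B)).
rewrite -compA hop_assoc (reassoc (triangle _ _)) -tens_compl braid_unitl.
by rewrite lunit_tens.
Qed.

Lemma swap4_unitl (D : braidedMonoidalCategory) (A B : D) :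
  (lunit A ⊗₁ lunit B) ∘ swap4 unitob unitob A B
  = lunit (A ⊗ B) ∘ (lunit unitob ⊗₁ idm (A ⊗ B)).
Proof.
rewrite tens_split -(lunit_tens A B) -!compA (reassoc (assoc_natr _ _ _)).
rewrite -!compA assoc_swap4 (reassoc (esym (tens_compr _ _ _))) hop_unitl.
by rewrite (reassoc (lunit_nat _)) -compA lunit_tens.
Qed.

Lemma swap4_unitr (D : braidedMonoidalCategory) (A B : D) :
  runit (A ⊗ B) ∘ (idm (A ⊗ B) ⊗₁ lunit unitob) ∘ swap4 A unitob B unitob
  = runit A ⊗₁ runit B.
Proof.
rewrite -runit_tens -!compA (reassoc (assoc_natr _ _ _)) -!compA assoc_swap4.
have := congr1 (tensm (idm A)) (hop_unitl B unitob); rewrite tens_compr => h.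
by rewrite (reassoc h) triangle tens_exch -tens_split.
Qed.

(** * The canonical Hopf module on [H ⊗ V] *)

Lemma left_module_canonical (D : braidedMonoidalCategory) (H : bialgebra D)
    (V : D) :
  left_module H (canonical_action H V).
Proof.
rewrite /canonical_action; split; last first.
  rewrite -!compA -[idm (H ⊗ V)]tens1 -assoc_inv_nat.
  rewrite (reassoc (esym (tens_compl _ _ _))) mul_unitl.
  by symmetry; apply: inv_r; rewrite lunit_tens.
rewrite tens_compr -!compA (reassoc (esym (assoc_inv_nat _ _ _))) -!compA.
rewrite pentagon_inv -[idm (H ⊗ V)]tens1 -assoc_inv_nat !compA -!tens_compl.
by rewrite mul_assoc.
Qed.

Lemma left_comodule_canonical (D : braidedMonoidalCategory) (H : bialgebra D)
    (V : D) :
  left_comodule H (canonical_coaction H V).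
Proof.
rewrite /canonical_coaction; split; last first.
  rewrite compA -assoc_natl.
  rewrite -compA -tens_compl delta_counitl.
  exact: assoc_lunit_inv.
rewrite -!compA (reassoc (esym (assoc_natl _ _ _))) -!compA.
rewrite (reassoc (esym (pentagonE _ _ _ _))) -!compA -!tens_compl.
have := delta_coassoc H; rewrite -compA => ->.
rewrite tens_compl (reassoc (assoc_nat _ _ _)).
by rewrite tens_compr -!compA.
Qed.

(** Multiplicativity of the coproduct, [delta_mul], with [V] as a spectator. *)
Lemma hopf_canonical (D : braidedMonoidalCategory) (H : bialgebra D)
    (V : D) :
  canonical_coaction H V ∘ canonical_action H V
  = (idm H ⊗₁ canonical_action H V)
      ∘ codiag_left_coaction H (canonical_coaction H V).
Proof.
rewrite /canonical_coaction /canonical_action /codiag_left_coaction swap4E.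
apply: (@iso_epic _ _ _ _ (assoc H H V)).
rewrite -!compA inv_fwd compm1 -tens_compl delta_mul swap4E !tens_compl -!compA.
rewrite (reassoc (assoc_nat _ _ _)) -!compA.
rewrite (reassoc (esym (tens_comp _ _ _ _))) comp1m compm1.
rewrite -[delta H in RHS]comp1m tens_comp.
rewrite -!compA -assoc_nat.
have := assoc_swap4_tens H H H H V.
rewrite -!compA => h.
rewrite (reassoc3 (esym h)) -!compA (reassoc (esym (tens_comp _ _ _ _))).
by rewrite -compA inv_fwd !compm1 comp1m.
Qed.

(** * The codiagonal right coaction is left-covariant *)

(** Coassociativity combines that of [delta H] and of [s] through [swap4_assocr], and [delta_mul]
    handles the product of the two right legs. The counit law rests on [eps_mul] and
    [swap4_unitr]. *)
Lemma codiag_right_comodule (D : braidedMonoidalCategory) (H : bialgebra D)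
    (V : D) (s : hom V (V ⊗ H)) :
  right_comodule H s -> right_comodule H (codiag_right_coaction H s).
Proof.
rewrite /codiag_right_coaction swap4E => -[sA s1]; split; last first.
  rewrite !compA -tens_compr eps_mul tens_compr -(tens1 H V).
  rewrite -!compA (reassoc (esym (swap4_nat _ _ _ _))) -!compA -tens_comp.
  rewrite delta_counitr s1 -[RHS]compm1; apply: inv_l.
  have := swap4_unitr H V; rewrite -(tens1 H V) -!compA => h.
  by rewrite (reassoc3 h) -tens_comp !fwd_inv.
have h := swap4_assocr H H H V H H; rewrite -!compA in h.
rewrite -!compA.
rewrite (reassoc (esym (tens_exch _ _))) -!compA.
rewrite (reassoc (assoc_natr _ _ _)) -!compA !tens_compl -!compA.
rewrite -(tens1 H H) (reassoc (esym (swap4_nat _ _ _ _))) -!compA.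
rewrite (reassoc (assoc_nat _ _ _)) tens1 -!compA (reassoc3 h) -!compA.
rewrite -!tens_comp !compA sA delta_coassoc -!compA.
rewrite tens_comp.
rewrite (reassoc (swap4_nat _ _ _ _)) tens1 -!compA.
by rewrite !compA -!tens_compr delta_mul swap4E -tens_comp comp1m compm1.
Qed.

(** Coassociativity of [delta H]: the left coaction splits off the first leg, while [swap4] and the
    product act on the remaining ones. *)
Lemma codiag_right_bicomodule (D : braidedMonoidalCategory)
    (H : bialgebra D) (V : D) (s : hom V (V ⊗ H)) :
  assoc H (H ⊗ V) H ∘ (canonical_coaction H V ⊗₁ idm H)
    ∘ codiag_right_coaction H s
  = (idm H ⊗₁ codiag_right_coaction H s) ∘ canonical_coaction H V.
Proof.
rewrite /codiag_right_coaction swap4E /canonical_coaction.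
have h := assoc_swap4_assoc H H H V H; rewrite -!compA in h.
rewrite -!compA.
rewrite (reassoc (esym (tens_exch _ _))) -!compA.
rewrite (reassoc (assoc_natr _ _ _)) -!compA !tens_compl -!compA.
rewrite -(tens1 H H) (reassoc (esym (swap4_nat _ _ _ _))) -!compA !tens1.
rewrite (reassoc3 h) -!compA -!tens_comp !comp1m.
have := delta_coassoc H; rewrite -compA => ->.
rewrite -[s in LHS]compm1 tens_comp (reassoc (assoc_nat _ _ _)) -!compA.
by rewrite !tens_compr -!compA.
Qed.

Lemma codiag_right_colinear (D : braidedMonoidalCategory)
    (H : bialgebra D) (V : D) (s : hom V (V ⊗ H)) :
  codiag_right_coaction H s ∘ canonical_action H V
  = (canonical_action H V ⊗₁ idm H)
      ∘ codiag_right_coaction H (codiag_right_coaction H s).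
Proof.
rewrite /codiag_right_coaction !swap4E /canonical_action.
have h := swap4_assocl H H V H H H; rewrite -!compA in h.
rewrite -!compA.
apply: (@iso_epic _ _ _ _ (assoc H H V)).
rewrite -!compA inv_fwd compm1 -tens_comp delta_mul swap4E compm1.
(* Middle form: all coproducts are taken first and the three right legs are multiplied last,
   bracketed to the left. The left side reaches it by naturality of [swap4], the right side by
   [swap4_assocl] and [mul_assoc]. *)
transitivity (((mul H ⊗₁ idm V) ⊗₁ (mul H ∘ (mul H ⊗₁ idm H)))
  ∘ (swap4 (H ⊗ H) (H ⊗ H) V H ∘ ((swap4 H H H H ⊗₁ idm (V ⊗ H))
  ∘ ((delta H ⊗₁ delta H) ⊗₁ s)))).
  have -> : ((mul H ⊗₁ mul H) ∘ swap4 H H H H ∘ (delta H ⊗₁ delta H)) ⊗₁ s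
      = ((mul H ⊗₁ mul H) ⊗₁ (idm V ⊗₁ idm H))
        ∘ ((swap4 H H H H ⊗₁ idm (V ⊗ H)) ∘ ((delta H ⊗₁ delta H) ⊗₁ s)).
    by rewrite -!tens_comp tens1 !comp1m compA.
  rewrite (reassoc (swap4_nat _ _ _ _)) -!compA.
  by rewrite (reassoc (esym (tens_comp _ _ _ _))) comp1m.
have -> : delta H ⊗₁ ((idm (H ⊗ V) ⊗₁ mul H)
      ∘ (swap4 H H V H ∘ (delta H ⊗₁ s)))
    = ((idm H ⊗₁ idm H) ⊗₁ (idm (H ⊗ V) ⊗₁ mul H))
      ∘ ((idm (H ⊗ H) ⊗₁ swap4 H H V H) ∘ (delta H ⊗₁ (delta H ⊗₁ s))).
  by rewrite -!tens_comp tens1 !comp1m.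
rewrite -!compA (reassoc (swap4_nat _ _ _ _)) -!compA -assoc_nat.
rewrite (reassoc3 (esym h)) tens1 -!compA !(reassoc (esym (tens_comp _ _ _ _))).
rewrite comp1m -mul_assoc !compm1 -(compA (mul H ⊗₁ idm V)) inv_fwd.
by rewrite compm1.
Qed.

(** * Coinvariants and the restriction of a right coaction to them *)

Definition coinv_proj (D : braidedMonoidalCategory) (H : bialgebra D) (V : D) :
    hom (H ⊗ V) V :=
  lunit V ∘ (eps H ⊗₁ idm V).

Definition coinv_inj (D : braidedMonoidalCategory) (H : bialgebra D) (V : D) :
    hom V (H ⊗ V) :=
  (eta H ⊗₁ idm V) ∘ inv (lunit V).

Lemma coinv_injK (D : braidedMonoidalCategory) (H : bialgebra D) (V : D) :
  coinv_proj H V ∘ coinv_inj H V = idm V.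
Proof.
rewrite /coinv_proj /coinv_inj -compA (reassoc (esym (tens_compl _ _ _))).
by rewrite eps_eta tens1 comp1m fwd_inv.
Qed.

Lemma lunit_inv_nat (D : monoidalCategory) (A A' : D) (f : hom A A') :
  inv (lunit A') ∘ f = (idm unitob ⊗₁ f) ∘ inv (lunit A).
Proof.
symmetry; apply: inv_l.
by rewrite (reassoc (lunit_nat _)) -compA fwd_inv compm1.
Qed.

(** The coinvariants generate [H ⊗ V]: in elements, h · (1 ⊗ v) = h ⊗ v. *)
Lemma canonical_action_inj (D : braidedMonoidalCategory) (H : bialgebra D)
    (V : D) :
  canonical_action H V ∘ (idm H ⊗₁ coinv_inj H V) = idm (H ⊗ V).
Proof.
rewrite /canonical_action /coinv_inj tens_compr -compA.
rewrite (reassoc (esym (assoc_inv_nat _ _ _))) -compA.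
rewrite (reassoc (esym (tens_compl _ _ _))) mul_unitr -triangle -compA invK.
by rewrite -tens_compr fwd_inv tens1.
Qed.

Lemma canonical_coaction_inj (D : braidedMonoidalCategory) (H : bialgebra D)
    (V : D) :
  canonical_coaction H V ∘ coinv_inj H V
  = (eta H ⊗₁ coinv_inj H V) ∘ inv (lunit V).
Proof.
rewrite /canonical_coaction /coinv_inj -compA.
rewrite (reassoc (esym (tens_compl _ _ _))) delta_eta tens_compl -compA.
have -> : eta H ⊗₁ ((eta H ⊗₁ idm V) ∘ inv (lunit V))
    = (eta H ⊗₁ (eta H ⊗₁ idm V)) ∘ (idm unitob ⊗₁ inv (lunit V)).
  by rewrite -tens_comp compm1.
rewrite (reassoc (assoc_nat _ _ _)) -!compA -lunit_inv_nat; congr (_ ∘ _).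
by rewrite compA assoc_lunit_inv.
Qed.

(** The right counit law of [H]. Through this identity a coinvariant is recovered from its
    projection to [V]. *)
Lemma coinv_proj_coaction (D : braidedMonoidalCategory) (H : bialgebra D)
    (V : D) :
  (idm H ⊗₁ coinv_proj H V) ∘ canonical_coaction H V = idm (H ⊗ V).
Proof.
rewrite /canonical_coaction /coinv_proj tens_compr -compA.
rewrite (reassoc (esym (assoc_nat _ _ _))) -compA -tens_compl delta_counitr.
by rewrite (reassoc (triangle _ _)) -tens_compl fwd_inv tens1.
Qed.

Definition coinv_coaction (D : braidedMonoidalCategory) (H : bialgebra D)
    (V : D) (sigma : hom (H ⊗ V) ((H ⊗ V) ⊗ H)) : hom V (V ⊗ H) :=
  (coinv_proj H V ⊗₁ idm H) ∘ (sigma ∘ coinv_inj H V).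

(** On coinvariants the bicomodule condition gives [sigma ∘ coinv_inj H V] a trivial left coaction.
    Projecting the inner [H ⊗ V] to [V] recovers this map on one side and leaves [eta H] tensored
    with the restricted coaction on the other. *)
Lemma coinv_coactionE (D : braidedMonoidalCategory) (H : bialgebra D)
    (V : D) (sigma : hom (H ⊗ V) ((H ⊗ V) ⊗ H)) :
  assoc H (H ⊗ V) H ∘ (canonical_coaction H V ⊗₁ idm H) ∘ sigma
    = (idm H ⊗₁ sigma) ∘ canonical_coaction H V ->
  sigma ∘ coinv_inj H V = (coinv_inj H V ⊗₁ idm H) ∘ coinv_coaction sigma.
Proof.
move=> bi; apply: (@iso_monic _ _ _ _ (assoc H V H)).
transitivity ((eta H ⊗₁ coinv_coaction sigma) ∘ inv (lunit V)).
  move: bi (canonical_coaction_inj H V) (coinv_proj_coaction H V).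
  rewrite /coinv_coaction.
  move: (canonical_coaction H V) (coinv_inj H V) (coinv_proj H V).
  move=> rho j p bi rho_j p_rho.
  have := congr1 (compm (idm H ⊗₁ (p ⊗₁ idm H))) (congr1 (compm^~ j) bi).
  rewrite /= -!compA rho_j !(reassoc (esym (tens_comp _ _ _ _))).
  rewrite (reassoc (esym (assoc_nat _ _ _))) -!compA.
  rewrite (reassoc (esym (tens_comp _ _ _ _))) p_rho.
  by rewrite !comp1m tens1 comp1m.
move: (coinv_coaction sigma) => s; rewrite /coinv_inj tens_compl -compA.
rewrite (reassoc (assoc_natl _ _ _)) -compA.
rewrite tens_split -compA -lunit_inv_nat; congr (_ ∘ _).
by rewrite [RHS]compA assoc_lunit_inv.
Qed.

(** By [coinv_coactionE] the inclusion [j] intertwines the two coactions, and [p] splits it even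
    after tensoring, so the comodule axioms of [sigma] descend along [j]. *)
Lemma coinv_right_comodule (D : braidedMonoidalCategory) (H : bialgebra D)
    (V : D) (sigma : hom (H ⊗ V) ((H ⊗ V) ⊗ H)) :
  left_covariant_bicomodule H
    (canonical_action H V) (canonical_coaction H V) sigma ->
  right_comodule H (coinv_coaction sigma).
Proof.
move=> [_ [sA s1] /coinv_coactionE + _].
have := coinv_injK H V.
move: (coinv_coaction sigma) (coinv_inj H V) (coinv_proj H V).
move=> s j p pj sj.
have j_monic X M (f g : hom M (V ⊗ X)) :
    (j ⊗₁ idm X) ∘ f = (j ⊗₁ idm X) ∘ g -> f = g.
  move/(congr1 (compm (p ⊗₁ idm X))).
  by rewrite !(reassoc (esym (tens_compl _ _ _))) pj tens1 !comp1m.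
split; apply: j_monic.
  rewrite -!compA (reassoc (esym (assoc_natl _ _ _))) -!compA.
  rewrite (reassoc (esym (tens_compl _ _ _))) -sj tens_compl -!compA -sj.
  by rewrite !compA sA -compA sj compA tens_exch.
rewrite compA -tens_exch -compA -sj compA s1.
apply: (@iso_monic _ _ _ _ (runit _)).
by rewrite invK (reassoc (runit_nat _)) -compA fwd_inv compm1.
Qed.

(** Writing the identity as [psi ∘ (idm H ⊗₁ j)] and using colinearity expresses [sigma] through
    [sigma ∘ j], that is, through [s]; the same identity then absorbs [psi] and [j] again. *)
Lemma codiag_coinv_coaction (D : braidedMonoidalCategory) (H : bialgebra D)
    (V : D) (sigma : hom (H ⊗ V) ((H ⊗ V) ⊗ H)) :
  left_covariant_bicomodule H
    (canonical_action H V) (canonical_coaction H V) sigma ->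
  codiag_right_coaction H (coinv_coaction sigma) = sigma.
Proof.
move=> [_ _ /coinv_coactionE + sigma_psi].
have := canonical_action_inj H V; move: sigma_psi.
move: (coinv_coaction sigma) (coinv_inj H V) (canonical_action H V).
move=> s j psi sigma_psi psi_j sj.
rewrite -[RHS]compm1 -psi_j compA sigma_psi /codiag_right_coaction !swap4E.
rewrite -!compA -tens_comp compm1 sj.
have -> : delta H ⊗₁ ((j ⊗₁ idm H) ∘ s)
    = ((idm H ⊗₁ idm H) ⊗₁ (j ⊗₁ idm H)) ∘ (delta H ⊗₁ s).
  by rewrite -tens_comp tens1 comp1m.
rewrite (reassoc (swap4_nat _ _ _ _)) tens1 -!compA.
rewrite !(reassoc (esym (tens_comp _ _ _ _))).
by rewrite compm1 psi_j comp1m compm1.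
Qed.

(** On coinvariants the coproduct only sees the unit, which splits as [eta H ⊗₁ eta H]; one copy is
    killed by [eps H] and the other is absorbed by the product. *)
Lemma coinv_codiag_coaction (D : braidedMonoidalCategory) (H : bialgebra D)
    (V : D) (s : hom V (V ⊗ H)) :
  coinv_coaction (codiag_right_coaction H s) = s.
Proof.
rewrite /coinv_coaction /codiag_right_coaction swap4E /coinv_inj.
rewrite -!compA (reassoc (esym (tens_comp (delta H) (eta H) _ _))) delta_eta.
rewrite compm1.
have -> : ((eta H ⊗₁ eta H) ∘ inv (lunit unitob)) ⊗₁ s
    = ((eta H ⊗₁ eta H) ⊗₁ (idm V ⊗₁ idm H)) ∘ (inv (lunit unitob) ⊗₁ s).
  by rewrite -tens_comp tens1 comp1m.
rewrite -!compA (reassoc (swap4_nat _ _ _ _)) -!compA.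
rewrite !(reassoc (esym (tens_comp _ _ _ _))) compm1 comp1m mul_unitl.
rewrite /coinv_proj -(compA (lunit V)) -tens_compl eps_eta tens1 compm1.
rewrite (reassoc (swap4_unitl _ _)) -!compA.
rewrite (reassoc (esym (tens_comp _ _ _ _))).
by rewrite fwd_inv comp1m -lunit_inv_nat invK.
Qed.

(** * The bijection between the two kinds of coactions *)

Lemma codiag_left_covariant (D : braidedMonoidalCategory) (H : bialgebra D)
    (V : D) (s : hom V (V ⊗ H)) :
  right_comodule H s ->
  left_covariant_bicomodule H
    (canonical_action H V) (canonical_coaction H V) (codiag_right_coaction H s).
Proof.
move=> sP; split.
- split; [exact: left_module_canonical | exact: left_comodule_canonical |].
  exact: hopf_canonical.
- exact: codiag_right_comodule.
- exact: codiag_right_bicomodule.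
- exact: codiag_right_colinear.
Qed.

Theorem corollary3p6 (C : braidedMonoidalCategory) (H : bialgebra (tilde_H C))
    (V : tilde_H C) :
  exists F :
    {sigma : hom (H ⊗ V) ((H ⊗ V) ⊗ H) |
      left_covariant_bicomodule H
        (canonical_action H V) (canonical_coaction H V) sigma} ->
    {sigma : hom V (V ⊗ H) | right_comodule H sigma},
    bijective F.
Proof.
exists (fun x => exist _ _ (coinv_right_comodule (proj2_sig x))).
exists (fun x => exist _ _ (codiag_left_covariant (proj2_sig x))).
  move=> [sigma P]; apply: subset_eq_compat.
  exact: codiag_coinv_coaction.
by move=> [s P]; apply: subset_eq_compat; apply: coinv_codiag_coaction.
Qed.
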